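(* Let $m=\prod_{j=1}^t p_j^{\alpha_j}$ with primes $5\le p_1<\dots<p_t$ and positive integers $\alpha_j$, and let $f:\mathbb{Z}_3^3\to\mathbb{Z}_m$ be a generalized bent function. Then for each nonzero $x\in\mathbb{Z}_3^3$, $E_x$ has one of the following forms, for some integers $\alpha_x,\beta_x,\gamma_x,\delta_x,\omega_x$: (i) $E_x=D_5(g^{\alpha_x}+g^{\beta_x}+g^{\gamma_x}+g^{\delta_x})+D_7g^{\omega_x}$; (ii) $E_x=D_5g^{\alpha_x}+D_{11}(g^{\beta_x}+g^{\gamma_x})$; (iii) $E_x=D_5(g^{\alpha_x}+g^{\beta_x})+D_{17}g^{\gamma_x}$; (iv) $E_x=D_7(g^{\alpha_x}+g^{\beta_x})+D_{13}g^{\gamma_x}$.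
   Context: A function $f:G\to\mathbb{Z}_m$ on a finite abelian group $G$ is a generalized bent function if $\left|\sum_{x\in G}\zeta_m^{f(x)}\chi(x)\right|^2=|G|$ for every character $\chi$ of $G$, where $\zeta_m$ is a primitive $m$-th root of unity. $C_m$ is the multiplicative cyclic group of order $m$ with generator $g$. For $x\in\mathbb{Z}_3^3$, $E_x=\sum_{y\in\mathbb{Z}_3^3}g^{f(x+y)-f(y)}\in\mathbb{Z}[C_m]$. For a divisor $d$ of $m$, $D_d$ denotes the group ring element $\sum_{h\in H_d}h\in\mathbb{Z}[C_m]$, where $H_d$ is the unique subgroup of $C_m$ of order $d$ (so $D_d$ appearing in a form implicitly requires $d\mid m$). *)

(* Defs.v *)
From HB Require Import structures.
From mathcomp Require Import all_boot all_order all_algebra all_fingroup.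
From mathcomp Require Import all_solvable all_field all_character.

Set Implicit Arguments.
Unset Strict Implicit.
Unset Printing Implicit Defensive.

Import Order.TTheory GRing.Theory Num.Theory.
Local Open Scope ring_scope.

(* The integral group ring Z[gT].  This alias hides the pointwise product that *)
(* {ffun gT -> int} carries canonically: here [*] is the convolution product.  *)
Definition zgring (gT : finGroupType) : Type := {ffun gT -> int}.

Section GroupRing.
Variable gT : finGroupType.
Implicit Types a b c : zgring gT.

HB.instance Definition _ := GRing.Zmodule.copy (zgring gT) {ffun gT -> int}.

Definition zg_elt (h : gT) : zgring gT := [ffun k => (k == h)%:R].

Definition zg_mul a b : zgring gT := [ffun k => \sum_h a h * b (h^-1 * k)%g].

Lemma zg_mulA : associative zg_mul.
Proof.
move=> a b c; apply/ffunP => k; rewrite !ffunE.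
under eq_bigr do rewrite ffunE mulr_sumr.
under [RHS]eq_bigr do rewrite ffunE mulr_suml.
rewrite [RHS]exchange_big /=; apply: eq_bigr => h _.
rewrite [RHS](reindex_inj (mulgI h)) /=; apply: eq_bigr => l _.
by rewrite mulKg invMg mulgA mulrA.
Qed.

Lemma zg_mul1 : left_id (zg_elt 1%g) zg_mul.
Proof.
move=> a; apply/ffunP => k; rewrite ffunE (bigD1 1%g) //= ffunE eqxx mul1r.
rewrite invg1 mul1g big1 ?addr0 // => h /negbTE h1.
by rewrite ffunE h1 mul0r.
Qed.

Lemma zg_mulr1 : right_id (zg_elt 1%g) zg_mul.
Proof.
move=> a; apply/ffunP => k; rewrite ffunE (bigD1 k) //= ffunE mulVg eqxx mulr1.
rewrite big1 ?addr0 // => h hk.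
by rewrite ffunE -eq_mulVg1 (negbTE hk) mulr0.
Qed.

Lemma zg_mulDl : left_distributive zg_mul +%R.
Proof.
move=> a b c; apply/ffunP => k; rewrite !ffunE -big_split /=.
by apply: eq_bigr => h _; rewrite ffunE mulrDl.
Qed.

Lemma zg_mulDr : right_distributive zg_mul +%R.
Proof.
move=> a b c; apply/ffunP => k; rewrite !ffunE -big_split /=.
by apply: eq_bigr => h _; rewrite ffunE mulrDr.
Qed.

Lemma zg_1neq0 : zg_elt 1%g != 0 :> zgring gT.
Proof. by apply/eqP => /ffunP/(_ 1%g); rewrite !ffunE eqxx. Qed.

HB.instance Definition _ := GRing.Zmodule_isNzRing.Build (zgring gT)
  zg_mulA zg_mul1 zg_mulr1 zg_mulDl zg_mulDr zg_1neq0.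

Lemma zg_eltM (h k : gT) : zg_elt (h * k)%g = zg_elt h * zg_elt k.
Proof.
apply/ffunP => l; rewrite !ffunE (bigD1 h) //= !ffunE eqxx mul1r.
rewrite big1 ?addr0 => [|i /negbTE hi]; last by rewrite ffunE hi mul0r.
by rewrite -(inj_eq (mulgI h^-1%g)) mulKg.
Qed.

Definition expgz (h : gT) (n : int) : gT :=
  match n with Posz k => (h ^+ k)%g | Negz k => (h ^- k.+1)%g end.

(* The subgroup H_d of order d; it is unique when gT is cyclic, and the value  *)
(* is the (irrelevant) trivial group when there is no subgroup of order d.     *)
Definition subgroup_of_order (d : nat) : {group gT} :=
  odflt 1%G [pick H : {group gT} | #|H| == d].

Lemma card_subgroup_of_order (d : nat) :
  cyclic [set: gT] -> (d %| #|gT|)%N -> #|subgroup_of_order d| = d.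
Proof.
move=> /cyclicP[x Tx] dvd; rewrite /subgroup_of_order.
case: pickP => [H /eqP //|/(_ <[(x ^+ (#|gT| %/ d))%g]>%G)] /=.
have ox : #[x]%g = #|gT| by rewrite orderE -Tx cardsT.
have d0 : (0 < d)%N by apply: dvdn_gt0 dvd; rewrite -ox order_gt0.
by rewrite -orderE orderXdiv ox ?dvdn_div // divnA // mulKn ?eqxx // -ox order_gt0.
Qed.

Lemma subgroup_of_order_uniq (d : nat) (H : {group gT}) :
  cyclic [set: gT] -> #|H| = d -> subgroup_of_order d = H.
Proof.
move=> cT cH; apply/val_inj/eqP; rewrite /= (eq_subG_cyclic cT) ?subsetT //.
by rewrite card_subgroup_of_order // -?cH // -cardsT cardSg ?subsetT.
Qed.

Definition zg_D (d : nat) : zgring gT :=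
  \sum_(h in subgroup_of_order d) zg_elt h.

End GroupRing.

(* On an abelian group the characters in the sense of homomorphisms to the     *)
(* nonzero complex numbers are the linear characters.  The exponent of [z] is  *)
(* the representative of [f x] in [0, m), for 1 < m.                           *)
Definition generalized_bent (G : finZmodType) (m : nat) (z : algC)
    (f : G -> 'Z_m) : Prop :=
  forall chi : 'CF([set: G]), chi \is a linear_char ->
    `| \sum_(x : G) z ^+ f x * chi x | ^+ 2 = #|G|%:R.

Definition zg_E (G : finZmodType) (m : nat) (gT : finGroupType) (g : gT)
    (f : G -> 'Z_m) (x : G) : zgring gT :=
  \sum_(y : G) zg_elt (g ^+ (f (x + y) - f y)%R)%g.

(* Main.v *)
Require Import Defs.
From HB Require Import structures.
From mathcomp Require Import all_boot all_order all_algebra all_fingroup.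
From mathcomp Require Import all_solvable all_field all_character.
From mathcomp Require Import zify ring.

Set Implicit Arguments.
Unset Strict Implicit.
Unset Printing Implicit Defensive.

Import Order.TTheory GRing.Theory Num.Theory.
Local Open Scope ring_scope.

(* By Fourier inversion, bentness says that E_x vanishes under the faithful
   character chi of C_m, for x != 0.  So E_x is a vanishing sum of 27 roots of
   unity of order prime to 6, and it suffices to see that such a sum contains a
   coset of some subgroup of prime order: peeling cosets off one at a time then
   writes 27 as a sum of primes p >= 5 dividing m, which can be done in four ways.

   The claim is proved in the form [rigid], for two nonnegative sums A and B with
   disjoint supports, the same value under chi and |A| + 10 |B| <= 27: if A
   contains no prime coset, then A = B = 0.  Induct on the order of the subgroup H
   carrying A and B, splitting H over a subgroup K of prime index q.  If q divides
   |K|, the pieces over the cosets of K have equal values separately.  Otherwise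
   H = Q x K with |Q| = q, and the differences of the values of the pieces A_y and
   B_y (y in Q) do not depend on y.  Let j minimise |A_y| + 10 |B_y|.  If A_j = B_j = 0,
   induct on each pair (A_y, B_y).  Otherwise B_j = 0 and A_i has the same value as
   B_i + A_j for all i; by induction when q >= 11, and directly when q is 5 or 7,
   this forces A_i = A_j, so A contains a coset of Q. *)

(** * Sums over products and cosets, roots of unity, small primes *)

Lemma sum_mul_TI (R : nmodType) (gT : finGroupType) (H Q K : {group gT})
    (F : gT -> R) :
  (Q * K)%g = H -> (Q :&: K = 1)%g ->
  \sum_(h in H) F h = \sum_(y in Q) \sum_(k in K) F (y * k)%g.
Proof.
move=> defH tiQK.
rewrite (partition_big (divgr Q K) (mem Q)) /=; last first.
  by move=> h; rewrite -defH; apply: mem_divgr.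
apply: eq_bigr => y Qy; rewrite (reindex_inj (mulgI y)) /=.
apply: eq_bigl => k; apply/andP/idP => [[yk /eqP dy]|Kk].
  have ek := divgr_eq Q K (y * k)%g; rewrite dy in ek.
  by rewrite (mulgI _ _ _ ek) mem_remgr // defH.
by rewrite -defH mem_mulg // divgrMid.
Qed.

Lemma sum_root_of_unity (R : idomainType) (q : nat) (w : R) :
  w ^+ q = 1 -> \sum_(k < q) w ^+ k = if w == 1 then q%:R else 0.
Proof.
move=> wq; case: eqP => [->|/eqP w1].
  by under eq_bigr do rewrite expr1n; rewrite sumr_const card_ord.
have := subrX1 w q; rewrite wq subrr => /esym/eqP.
by rewrite mulf_eq0 subr_eq0 (negPf w1) => /eqP.
Qed.

(** Serves the case where the largest prime dividing the order is below 11: only 5 and 7 can then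
    occur together. *)
Lemma primes_5_7 p q : prime p -> prime q -> (5 <= p)%N -> (p < q)%N ->
  (q < 11)%N -> p = 5%N /\ q = 7%N.
Proof.
move=> pp pq p5 ltpq q11.
have : p \in iota 5 6 by rewrite mem_iota; lia.
have : q \in iota 5 6 by rewrite mem_iota; lia.
rewrite !inE => /or3P[| |/or3P[| |/orP[]]] /eqP Eq;
  by move=> /or3P[| |/or3P[| |/orP[]]] /eqP Ep; subst.
Qed.

Lemma sum_lcoset (R : nmodType) (gT : finGroupType) (Q : {group gT}) (y : gT)
    (F : gT -> R) :
  \sum_h F h *+ (y^-1 * h \in Q)%g = \sum_(k in Q) F (y * k)%g.
Proof.
rewrite (reindex_inj (mulgI y)) [RHS]big_mkcond /=; apply: eq_bigr => k _.
by rewrite mulKg; case: (k \in Q).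
Qed.

(** * Values of a faithful character of a cyclic group *)

Section VanishingSums.

Variables (gT : finGroupType) (chi : gT -> algC).
Hypothesis cycT : cyclic [set: gT].
Hypothesis chiM : {morph chi : h k / (h * k)%g >-> h * k}.
Hypothesis chi1 : chi 1%g = 1.
Hypothesis chi_inj : forall h, chi h = 1 -> h = 1%g.

Implicit Types (H K Q : {group gT}) (F : gT -> int) (A B : gT -> nat).

(** The value under [chi] of the group ring element with coefficients [F] restricted to [H]. *)
Definition csum H F : algC := \sum_(h in H) (F h)%:~R * chi h.

Lemma chiX h n : chi (h ^+ n)%g = chi h ^+ n.
Proof. by elim: n => [|n IH]; rewrite ?expg0 ?expr0 // expgS exprS chiM IH. Qed.

Lemma csum_translate H F y : y \in H ->
  csum H F = chi y * csum H (fun h => F (y * h)%g).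
Proof.
move=> Hy; rewrite /csum mulr_sumr (reindex_inj (mulgI y)) /=.
by apply: eq_big => [h|h _]; rewrite ?groupMl // chiM mulrCA.
Qed.

Lemma chi_neq0 h : chi h != 0.
Proof.
apply/eqP => h0; have := chi1; rewrite -(mulgV h) chiM h0 mul0r => /esym/eqP.
by rewrite oner_eq0.
Qed.

Lemma csum_translate_eq0 H F y : y \in H -> csum H F = 0 ->
  csum H (fun h => F (y * h)%g) = 0.
Proof.
move=> Hy /eqP; rewrite (csum_translate F Hy) mulf_eq0 (negPf (chi_neq0 y)).
by move/eqP.
Qed.

Lemma csumB H F1 F2 :
  csum H (fun h => F1 h - F2 h) = csum H F1 - csum H F2.
Proof.
by rewrite /csum -sumrB; apply: eq_bigr => h _; rewrite intrB mulrBl.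
Qed.

(** A Galois automorphism raising the [#|H|]-th roots of unity to the power [u] fixes the integer
    coefficients and carries one relation to the other. *)
Lemma csum_conjugate H F u : coprime u #|H| -> csum H F = 0 ->
  \sum_(h in H) (F h)%:~R * chi h ^+ u = 0.
Proof.
move=> cou F0; have [s sE] := Qn_aut_exists cou.
transitivity (s (csum H F)); last by rewrite F0 rmorph0.
rewrite rmorph_sum; apply: eq_bigr => h Hh.
by rewrite rmorphM rmorph_int sE // -chiX expg_cardG.
Qed.

Lemma mem_sub_cyclic K h : (h \in K) = (h ^+ #|K| == 1)%g.
Proof.
apply/idP/eqP => [/expg_cardG //|hK].
rewrite -cycle_subG -(cardSg_cyclic cycT) ?subsetT // -orderE.
by rewrite order_dvdn hK.
Qed.

(* The Galois conjugations fixing the values of [chi] on [K] multiply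
   [chi h] by all powers of the [q]-th root of unity [chi (h ^+ #|K|)]. *)
Lemma csum_subgroup_eq0 H K F q : K \subset H -> #|H| = (q * #|K|)%N ->
  (q %| #|K|)%N -> csum H F = 0 -> csum K F = 0.
Proof.
move=> sKH oH qK F0; set n := #|K|.
have q0 : (q > 0)%N by move: (cardG_gt0 H); rewrite oH muln_gt0 => /andP[].
have con k : coprime (1 + n * k) #|H|.
  (* Since [q] divides [n], the order [q * n] of [H] divides [n ^ 2], and [1 + n * k] is coprime to
     [n]. *)
  apply: (@coprime_dvdr _ (n ^ 2)); first by rewrite oH -mulnn dvdn_mul.
  by rewrite coprimeXr // coprime_sym /coprime addnC mulnC gcdnMDl gcdn1.
have : \sum_(k < q) \sum_(h in H) (F h)%:~R * chi h ^+ (1 + n * k) = 0.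
  by rewrite big1 // => k _; apply: csum_conjugate.
rewrite exchange_big /= => S0.
have : q%:R * csum K F = 0.
  rewrite -{}S0 /csum mulr_sumr [RHS](bigID (mem K)) /= [X in _ + X]big1 ?addr0.
    apply: eq_big => [h|h Kh]; first by case Kh: (h \in K); rewrite ?andbF ?(subsetP sKH).
    rewrite (eq_bigr (fun=> (F h)%:~R * chi h)) => [|k _].
      by rewrite sumr_const card_ord mulr_natl.
    by rewrite exprD expr1 exprM -chiX expg_cardG // chi1 expr1n mulr1.
  move=> h /andP[Hh nKh]; under eq_bigr do rewrite exprD expr1 exprM mulrA -chiX.
  rewrite -mulr_sumr sum_root_of_unity.
    by case: eqP => [/chi_inj/eqP|]; rewrite ?mulr0 // -mem_sub_cyclic (negPf nKh).
  by rewrite -chiX -expgM mulnC -oH expg_cardG.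
by move/eqP; rewrite mulf_eq0 pnatr_eq0 (gtn_eqF q0) => /eqP.
Qed.

(* Here the conjugations fix the values on [K] and act transitively on the
   nontrivial characters of [Q], so that the Fourier transform of
   [y |-> csum K (F (y * _))] is supported at the trivial character. *)
Lemma csum_complement_const H Q K F q : (Q * K)%g = H -> #|Q| = q ->
  prime q -> coprime q #|K| -> csum H F = 0 ->
  {in Q &, forall y1 y2,
     csum K (fun k => F (y1 * k)%g) = csum K (fun k => F (y2 * k)%g)}.
Proof.
move=> defH oQ pq coqK.
have tiQK : (Q :&: K = 1)%g by apply: coprime_TIg; rewrite oQ.
have oH : #|H| = (q * #|K|)%N by rewrite -defH TI_cardMg // oQ.
have sQH : Q \subset H by rewrite -defH mulG_subl.
have q0 := prime_gt0 pq.
pose c F y := csum K (fun k => F (y * k)%g).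
(* Fourier inversion at the identity of [Q]: in the double sum over [k] and [y], only [k = 0]
   survives one way and only [y = 1] the other way. *)
have c1 F' : csum H F' = 0 -> q%:R * c F' 1%g = \sum_(y in Q) c F' y.
  move=> F0.
  have ck k : (0 < k < q)%N -> \sum_(y in Q) c F' y * chi y ^+ k = 0.
    move=> kq; pose u := chinese q #|K| k 1.
    have uq : u = k %[mod q] by apply: chinese_modl.
    have uK : u = 1 %[mod #|K|] by apply: chinese_modr.
    have cou : coprime u #|H|.
      rewrite oH coprimeMr -coprime_modl uq coprime_modl coprime_sym.
      rewrite prime_coprime // gtnNdvd ?(andP kq).1 ?(andP kq).2 //=.
      by rewrite -coprime_modl uK coprime_modl coprime1n.
    apply: etrans (csum_conjugate cou F0); rewrite (sum_mul_TI _ defH tiQK).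
    apply: eq_bigr => y Qy; rewrite /c /csum mulr_suml; apply: eq_bigr => h Kh.
    rewrite -mulrA; congr (_ * _); rewrite chiM exprMn -!chiX mulrC.
    congr (_ * _); congr (chi _).
      by rewrite -(expg_mod u (expg_cardG Qy)) oQ uq -oQ expg_mod ?expg_cardG.
    by rewrite -(expg_mod u (expg_cardG Kh)) uK expg_mod ?expg_cardG ?expg1.
  have : \sum_(k < q) \sum_(y in Q) c F' y * chi y ^+ k = \sum_(y in Q) c F' y.
    rewrite (bigD1 (Ordinal q0)) //= [X in _ + X]big1 ?addr0.
      by apply: eq_bigr => y _; rewrite expr0 mulr1.
    by move=> k k0; apply: ck; rewrite ltn_ord lt0n andbT.
  move=> <-; rewrite exchange_big /= (bigD1 1%g) ?group1 //= [X in _ + X]big1.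
    by rewrite addr0 -mulr_sumr sum_root_of_unity chi1 ?expr1n // eqxx mulrC.
  move=> y /andP[Qy y1]; rewrite -mulr_sumr sum_root_of_unity.
    by case: eqP => [/chi_inj/eqP|]; rewrite ?mulr0 // (negPf y1).
  by rewrite -chiX -oQ expg_cardG.
move=> F0; suff cy y : y \in Q -> q%:R * c F y = \sum_(x in Q) c F x.
  move=> y1 y2 Q1 Q2; apply: (mulfI (x := q%:R)); first by rewrite pnatr_eq0 -lt0n.
  by rewrite -/(c F y1) -/(c F y2) !cy.
(* Inversion at [y] is inversion at the identity for the translate of [F] by [y]. *)
move=> Qy; have Hy := subsetP sQH y Qy.
have cM x : c (fun h => F (y * h)%g) x = c F (y * x)%g.
  by apply: eq_bigr => k _; rewrite mulgA.
have := c1 _ (csum_translate_eq0 Hy F0); rewrite cM mulg1 => ->.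
rewrite [RHS](reindex_inj (mulgI y)) /=.
by apply: eq_big => [x|x _]; rewrite ?groupMl.
Qed.

(** * Rigidity of vanishing sums of small weight *)

Definition weight H A : nat := \sum_(h in H) A h.

Definition coset_free H A : Prop :=
  forall Q y, Q \subset H -> prime #|Q| -> y \in H ->
  exists2 h, h \in Q & A (y * h)%g = 0%N.

(** The bound 27 is the order of $\mathbb{Z}_3^3$. [B] is there for the induction: a piece shared by
    all [q] cosets is counted at least 10 more times in [A] when [q >= 11], which pays for moving it
    once into [B]. *)
Definition rigid H : Prop :=
  forall A B, csum H (fun h => (A h)%:Z - (B h)%:Z) = 0 ->
  (weight H A + 10 * weight H B <= 27)%N ->
  {in H, forall h, A h = 0%N \/ B h = 0%N} -> coset_free H A ->
  {in H, forall h, A h = 0%N /\ B h = 0%N}.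

Lemma csum_card1 H F : #|H| = 1%N -> csum H F = (F 1%g)%:~R.
Proof.
move=> /eqP; rewrite -trivg_card1 /csum => /eqP ->.
by rewrite big_set1 chi1 mulr1.
Qed.

Lemma mem_card1 H h : #|H| = 1%N -> h \in H -> h = 1%g.
Proof. by move=> /eqP; rewrite -trivg_card1 => /eqP ->; move/set1P. Qed.

(** The case of a trivial complement: in prime order, the only integer relations among the values of
    [chi] are the multiples of the full sum. *)
Lemma csum_prime_const H F : prime #|H| -> csum H F = 0 ->
  {in H &, forall h k, F h = F k}.
Proof.
move=> pH F0 h k Hh Hk.
have := csum_complement_const (mulg1 H) erefl pH _ F0.
rewrite cards1 coprimen1 => /(_ isT h k Hh Hk).
by rewrite !csum_card1 ?cards1 // !mulg1 => /eqP; rewrite eqr_int => /eqP.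
Qed.

Lemma weight_sub H K A y : K \subset H -> y \in H ->
  (weight K (fun k => A (y * k)%g) <= weight H A)%N.
Proof.
move=> sKH Hy; rewrite /weight [leqRHS](reindex_inj (mulgI y)) /=.
rewrite [leqRHS](bigID (mem K)) /=; apply: leq_trans (leq_addr _ _).
apply: eq_leq; apply: eq_bigl => k; rewrite groupMl //.
by case Kk: (k \in K); rewrite ?andbF ?(subsetP sKH).
Qed.

Lemma coset_free_sub H K A y : K \subset H -> y \in H ->
  coset_free H A -> coset_free K (fun k => A (y * k)%g).
Proof.
move=> sKH Hy cfA Q x sQK pQ Kx.
have [h Qh Ah] := cfA Q (y * x)%g (subset_trans sQK sKH) pQ
                      (groupM Hy (subsetP sKH x Kx)).
by exists h; rewrite // mulgA.
Qed.

Lemma weight_gt0P H A : reflect (exists2 h, h \in H & (0 < A h)%N) (0 < weight H A)%N.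
Proof.
rewrite lt0n sum_nat_eq0 negb_forall; apply: (iffP existsP) => [[h]|[h Hh Ah]].
  by rewrite negb_imply -lt0n => /andP[]; exists h.
by exists h; rewrite negb_imply Hh -lt0n.
Qed.

Lemma weight_eq0 H A : weight H A = 0%N -> {in H, forall h, A h = 0%N}.
Proof.
move=> /eqP w0 h Hh; move: w0; rewrite /weight sum_nat_eq0 => /forallP/(_ h).
by rewrite Hh => /eqP.
Qed.

Lemma weight_zero H A : (weight H A < #|H|)%N -> exists2 h, h \in H & A h = 0%N.
Proof.
move=> w; have [/existsP[h /andP[Hh /eqP]]|] := boolP [exists h in H, A h == 0%N].
  by exists h.
rewrite negb_exists_in => /forall_inP A0; move: w.
rewrite ltnNge -sum1_card leq_sum // => h Hh.
by rewrite lt0n A0.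
Qed.

Lemma rigid_card1 H : #|H| = 1%N -> rigid H.
Proof.
move=> oH A B; rewrite csum_card1 // => /eqP; rewrite intr_eq0 => AB _ dis _ h Hh.
rewrite (mem_card1 oH Hh); move: AB (dis 1%g (group1 H)).
move: (A _) (B _) => a b; lia.
Qed.

Lemma rigid_square H K q : K \subset H -> #|H| = (q * #|K|)%N ->
  (q %| #|K|)%N -> rigid K -> rigid H.
Proof.
move=> sKH oH qK rK A B AB0 w dis cfA y Hy.
have := csum_subgroup_eq0 sKH oH qK (csum_translate_eq0 Hy AB0) => /= ABy.
have {}w : (weight K (fun k => A (y * k)%g) + 10 * weight K (fun k => B (y * k)%g) <= 27)%N.
  by have := weight_sub A sKH Hy; have := weight_sub B sKH Hy; lia.
have := rK _ _ ABy w _ (coset_free_sub sKH Hy cfA) 1%g (group1 K).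
by rewrite mulg1; apply=> k Kk; apply: dis; rewrite groupM // (subsetP sKH).
Qed.

(** Here [A] and [B] are the pieces over one coset of [K] and [A'] is the lightest piece. Each of
    the other [q - 1] cosets weighs at least as much as [A'], whence the factor [q.-1]. *)
Definition matching K q : Prop :=
  forall A A' B, csum K (fun k => (A k)%:Z - (B k)%:Z - (A' k)%:Z) = 0 ->
  (weight K A + 10 * weight K B + q.-1 * weight K A' <= 27)%N ->
  {in K, forall k, A k = 0%N \/ B k = 0%N} -> coset_free K A ->
  (0 < weight K A')%N -> {in K, forall k, A k = A' k /\ B k = 0%N}.

Lemma matching_card1 K q : #|K| = 1%N -> matching K q.
Proof.
move=> oK A A' B; rewrite csum_card1 // => /eqP; rewrite intr_eq0 => AB _ dis _ _ k Kk.
have := dis k Kk; rewrite (mem_card1 oK Kk).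
move: (A _) (A' _) (B _) AB => a a' b; lia.
Qed.

(** The difference [A - B - A'] is constant on [K]. It is at most 0 where [A] vanishes and at least
    0 where [B + A'] vanishes; both points exist, so it is 0. *)
Lemma matching_card5 K q : #|K| = 5%N -> (7 <= q)%N -> matching K q.
Proof.
move=> oK q7 A A' B AB w dis cfA w0 k Kk.
have pK : prime #|K| by rewrite oK.
have [h Kh Ah] := cfA K 1%g (subxx _) pK (group1 K); rewrite mul1g in Ah.
(* As [q.-1 >= 6], six times the weight of [B + A'] is at most 27, so this weight is less than 5. *)
have [l Kl ABl] : exists2 l, l \in K & (B l + A' l)%N = 0%N.
  apply: weight_zero; rewrite /weight big_split /= -!/(weight _ _) oK.
  have : (6 * weight K A' <= q.-1 * weight K A')%N by rewrite leq_mul2r; lia.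
  lia.
have E1 := csum_prime_const pK AB Kk Kh; have E2 := csum_prime_const pK AB Kk Kl.
by have := dis k Kk; rewrite /= in E1 E2; lia.
Qed.

(* Cancelling the part common to [A] and [A'] makes the pair disjoint;
   [q.-1 >= 10] is what keeps its total weight within the bound of [rigid]. *)
Lemma matching_rigid K q : rigid K -> (11 <= q)%N -> matching K q.
Proof.
move=> rK q11 A A' B AB w dis cfA _ k Kk.
pose A1 h := (A h - A' h)%N; pose B1 h := (B h + (A' h - A h))%N.
have AB1 : csum K (fun h => (A1 h)%:Z - (B1 h)%:Z) = 0.
  by rewrite -AB; apply: eq_bigr => h _; congr (_%:~R * _); rewrite /A1 /B1; lia.
have w1 : (weight K A1 + 10 * weight K B1 <= 27)%N.
  have wA : (weight K A1 <= weight K A)%N by apply: leq_sum => h _; apply: leq_subr.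
  have wB : (weight K B1 <= weight K B + weight K A')%N.
    by rewrite -big_split; apply: leq_sum => h _; rewrite leq_add2l leq_subr.
  have : (10 * weight K A' <= q.-1 * weight K A')%N by rewrite leq_mul2r; lia.
  lia.
have dis1 : {in K, forall h, A1 h = 0%N \/ B1 h = 0%N}.
  by move=> h Kh; have := dis h Kh; rewrite /A1 /B1; lia.
have cf1 : coset_free K A1.
  move=> Q y sQK pQ Ky; have [h Qh Ah] := cfA Q y sQK pQ Ky.
  by exists h; rewrite // /A1 Ah.
by have := rK _ _ AB1 w1 dis1 cf1 k Kk; rewrite /A1 /B1; lia.
Qed.

Lemma rigid_coprime H Q K q : (Q * K)%g = H -> #|Q| = q -> prime q ->
  (5 <= q)%N -> coprime q #|K| -> rigid K -> matching K q -> rigid H.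
Proof.
move=> defH oQ pq q5 coqK rK mK A B AB0 w dis cfA.
have tiQK : (Q :&: K = 1)%g by apply: coprime_TIg; rewrite oQ.
have sQH : Q \subset H by rewrite -defH mulG_subl.
have sKH : K \subset H by rewrite -defH mulG_subr.
have cst := csum_complement_const defH oQ pq coqK AB0; rewrite /= in cst.
pose wA y := weight K (fun k => A (y * k)%g).
pose wB y := weight K (fun k => B (y * k)%g).
pose T y := (wA y + 10 * wB y)%N.
have sT : (\sum_(y in Q) T y <= 27)%N.
  apply: leq_trans w; rewrite /weight !(sum_mul_TI _ defH tiQK) big_distrr /=.
  by rewrite -big_split.
have disy y : y \in Q -> {in K, forall k : gT, A (y * k)%g = 0%N \/ B (y * k)%g = 0%N}.
  move=> Qy k Kk; apply: dis; apply: groupM; first exact: (subsetP sQH).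
  exact: (subsetP sKH).
have cfy y : y \in Q -> coset_free K (fun k => A (y * k)%g).
  by move=> Qy; apply: coset_free_sub cfA; rewrite ?(subsetP sQH).
have Tle i : i \in Q -> (T i <= 27)%N.
  by move=> Qi; apply: leq_trans sT; rewrite (bigD1 i) //= leq_addr.
pose j := [arg min_(i < 1%g in Q) T i]%g.
have [Qj minT] : j \in Q /\ forall i, i \in Q -> (T j <= T i)%N.
  by rewrite /j; case: arg_minnP => //; exact: group1.
suff van : {in Q & K, forall y k, A (y * k)%g = 0%N /\ B (y * k)%g = 0%N}.
  by move=> h; rewrite -defH => /mulsgP[y k Qy Kk ->]; apply: van.
(* If the lightest coset carries nothing, the common value of the differences is 0 and the rigidity
   of [K] applies to each coset. *)
have [Tj0|Tj0] := posnP (T j).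
  move=> y k Qy Kk; apply: (rK (fun k => A (y * k)%g) (fun k => B (y * k)%g)) => //.
  - rewrite (cst y j) // /csum big1 // => h Kh.
    rewrite (weight_eq0 (A := fun k => A (j * k)%g) _ Kh).
      rewrite (weight_eq0 (A := fun k => B (j * k)%g) _ Kh) ?subrr ?mul0r //.
      by rewrite -/(wB j); move: Tj0; rewrite /T; lia.
    by rewrite -/(wA j); move: Tj0; rewrite /T; lia.
  - exact: (Tle y Qy).
  - exact: disy.
  - exact: cfy.
have sTj i : i \in Q -> (T i + q.-1 * T j <= 27)%N.
  move=> Qi; apply: leq_trans sT; rewrite (bigD1 i) //= leq_add2l.
  have -> : q.-1 = #|Q :\ i| by rewrite -oQ (cardsD1 i) Qi.
  rewrite -sum_nat_const (eq_bigl (fun y => (y \in Q) && (y != i))).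
    by apply: leq_sum => y /andP[Qy _]; apply: minT.
  by move=> y; rewrite !inE andbC.
(* All [q >= 5] cosets weigh at least [T j], so [5 * T j <= 27], whereas a single term of [B]
   already costs 10. *)
have wBj : wB j = 0%N.
  have : (4 * T j <= q.-1 * T j)%N by rewrite leq_mul2r; lia.
  by have := sTj j Qj; rewrite /T; lia.
have TjE : T j = wA j by rewrite /T wBj muln0 addn0.
have eqA i : i \in Q -> {in K, forall k, A (i * k)%g = A (j * k)%g}.
  move=> Qi k Kk; apply: (mK (fun k => A (i * k)%g) (fun k => A (j * k)%g)
                             (fun k => B (i * k)%g) _ _ _ _ _ k Kk).1.
  - transitivity (csum K (fun k => ((A (i * k)%g)%:Z - (B (i * k)%g)%:Z)
                          - ((A (j * k)%g)%:Z - (B (j * k)%g)%:Z))).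
      apply: eq_bigr => h Kh.
      by rewrite (weight_eq0 (A := fun k => B (j * k)%g) wBj Kh) subr0.
    by rewrite csumB (cst i j) // subrr.
  - by rewrite -/(wA i) -/(wB i) -/(wA j) -TjE; apply: sTj.
  - exact: disy.
  - exact: cfy.
  - by rewrite -/(wA j) -TjE.
(* By [eqA], a point [k] of the support of the [j]-th piece puts the whole coset of [Q] through [k]
   in the support of [A]. *)
have [k Kk Ajk] : exists2 k, k \in K & (0 < A (j * k)%g)%N.
  by apply/weight_gt0P; rewrite -/(wA j) -TjE.
have pQ : prime #|Q| by rewrite oQ.
have [y Qy] := cfA Q k sQH pQ (subsetP sKH k Kk).
rewrite (centsP (sub_abelian_cent2 (cyclic_abelian cycT) (subsetT K) (subsetT Q)) k Kk y Qy).
by rewrite eqA // => Ajk0; rewrite Ajk0 in Ajk.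
Qed.

Lemma exists_subgroup H d : (d %| #|H|)%N ->
  exists2 K : {group gT}, K \subset H & #|K| = d.
Proof.
move=> dH; have oK : #|subgroup_of_order gT d| = d.
  apply: card_subgroup_of_order cycT _.
  by rewrite -cardsT (dvdn_trans dH) // cardSg ?subsetT.
exists (subgroup_of_order gT d) => //.
by rewrite -(cardSg_cyclic cycT) ?subsetT // oK.
Qed.

Lemma rigidity H : (forall p, prime p -> (p %| #|H|)%N -> (5 <= p)%N) -> rigid H.
Proof.
have [n] := ubnP #|H|; elim: n H => // n IHn H /ltnSE leHn p5.
have [|H1] := leqP #|H| 1.
  by move=> H1; apply: rigid_card1; apply/eqP; rewrite eqn_leq H1 cardG_gt0.
have sub q : prime q -> (q %| #|H|)%N -> exists K : {group gT},
    [/\ K \subset H, #|H| = (q * #|K|)%N & rigid K].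
  move=> pq qH; have [K sKH oK] := exists_subgroup (dvdn_div qH).
  have oH : #|H| = (q * #|K|)%N by rewrite oK mulnC divnK.
  exists K; split=> //; apply: IHn => [|p pp pK].
    apply: leq_trans leHn; rewrite oH -[ltnLHS]mul1n ltn_mul2r cardG_gt0.
    exact: prime_gt1.
  by apply: p5; rewrite // oH dvdn_mull.
(* Removing the factor 25 first ensures that, when the largest prime is 7 and does not divide
   [#|K|], the complement [K] has order 1 or 5. *)
have [d25|d25] := boolP (25 %| #|H|)%N.
  have [|K [sKH oH rK]] := @sub 5%N isT; first exact: dvdn_trans d25.
  by apply: (rigid_square sKH oH) rK; rewrite -(@dvdn_pmul2l 5) // -oH.
pose q := max_pdiv #|H|.
have pq : prime q by apply: max_pdiv_prime.
have qH : (q %| #|H|)%N by apply: max_pdiv_dvd.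
have qmax p : prime p -> (p %| #|H|)%N -> (p <= q)%N.
  by move=> pp pH; apply: max_pdiv_max; rewrite mem_primes pp pH cardG_gt0.
have q5 := p5 q pq qH.
have [K [sKH oH rK]] := sub q pq qH.
have [qK|qK] := boolP (q %| #|K|)%N; first exact: rigid_square sKH oH qK rK.
have [Q sQH oQ] := exists_subgroup qH.
have coqK : coprime q #|K| by rewrite prime_coprime.
have defH : (Q * K)%g = H.
  apply/eqP; rewrite eqEcard mul_subG //= oH -oQ TI_cardMg //.
  by apply: coprime_TIg; rewrite oQ.
apply: (rigid_coprime defH oQ) => //.
have [q11|q11] := leqP 11 q; first exact: matching_rigid.
(* Primes dividing [#|K|] are smaller than [q], so for [q < 11] the only possibility is 5 below
   7. *)
have Kp p : prime p -> (p %| #|K|)%N -> p = 5%N /\ q = 7%N.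
  move=> pp pK; have pH : (p %| #|H|)%N by rewrite oH dvdn_mull.
  apply: primes_5_7 => //; [exact: p5 | rewrite ltn_neqAle qmax // andbT].
  by apply: contraNneq qK => <-.
have [K1|K1] := leqP #|K| 1.
  by apply: matching_card1; apply/eqP; rewrite eqn_leq K1 cardG_gt0.
have [pK q7] := Kp _ (pdiv_prime K1) (pdiv_dvd _).
have K5 : (5 %| #|K|)%N by rewrite -pK pdiv_dvd.
apply: matching_card5; last by rewrite q7.
(* A further prime factor of [#|K|] would again be 5, against the exclusion of 25. *)
have [|] := leqP (#|K| %/ 5) 1; first by move/divnK: K5; lia.
move=> K51; have [p5' _] := Kp _ (pdiv_prime K51) (dvdn_trans (pdiv_dvd _) (dvdn_div K5)).
have K55 : (5 %| #|K| %/ 5)%N by rewrite -{1}p5' pdiv_dvd.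
case/negP: d25; rewrite oH dvdn_mull // -(divnK K5).
exact: (@dvdn_mul 5 5).
Qed.

(** * Peeling off cosets of prime order *)

Lemma sum_chi_eq0 Q : (1 < #|Q|)%N -> \sum_(h in Q) chi h = 0.
Proof.
move=> Q1; have [x Qx x1] : exists2 x, x \in Q & x != 1%g.
  have : ~~ (Q \subset [1 gT]%g) by rewrite subG1 trivg_card1 gtn_eqF.
  by case/subsetPn => x Qx; rewrite inE; exists x.
have : (chi x - 1) * \sum_(h in Q) chi h = 0.
  rewrite mulrBl mul1r mulr_sumr [X in _ - X](reindex_inj (mulgI x)) /=.
  apply/eqP; rewrite subr_eq0; apply/eqP; apply: eq_big => [h|h _]; last by rewrite chiM.
  by rewrite groupMl.
move/eqP; rewrite mulf_eq0 subr_eq0 => /orP[/eqP/chi_inj/eqP|/eqP//].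
by rewrite (negPf x1).
Qed.

(** Removing a coset of prime order keeps the sum zero, and by rigidity with [B = 0] this stops only
    at [A = 0]. The list [s p] holds representatives of the removed cosets of order [p]; the total
    multiplicity 27 keeps [p] below 28. *)
Lemma coset_decomposition A :
  (forall p, prime p -> (p %| #|gT|)%N -> (5 <= p)%N) ->
  \sum_h chi h *+ A h = 0 -> (\sum_h A h <= 27)%N ->
  exists s : nat -> seq gT,
  [/\ forall p, s p != [::] -> prime p && (p %| #|gT|)%N,
      \sum_h zg_elt h *+ A h
        = \sum_(p < 28) zg_D gT p * \sum_(y <- s p) zg_elt y
    & (\sum_h A h = \sum_(p < 28) p * size (s p))%N].
Proof.
move=> p5; have [n] := ubnP (\sum_h A h)%N; elim: n A => // n IHn A ltAn A0 w.
have [cf|] := boolP [forall Q : {group gT}, forall y,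
    prime #|Q| ==> [exists h in Q, A (y * h)%g == 0%N]].
  have A00 h : A h = 0%N.
    have := @rigidity [set: gT]%G _ A (fun=> 0%N) _ _ _ _ h (in_setT h).
    case=> //.
    - by move=> p pp; rewrite cardsT; apply: p5.
    - apply: etrans A0; apply: eq_big => [k|k _]; first by rewrite in_setT.
      by rewrite subr0 mulrC -[LHS]/(chi k * (A k)%:R) mulr_natr.
    - rewrite /weight [X in (10 * X)%N]big1 // muln0 addn0.
      by under eq_bigl do rewrite in_setT.
    - by right.
    move=> Q y _ pQ _.
    have /existsP[k /andP[Qk /eqP Ak]] := implyP (forallP (forallP cf Q) y) pQ.
    by exists k.
  exists (fun=> [::]); split=> //.
    rewrite big1 => [|h _]; last by rewrite A00.
    by rewrite big1 // => p _; rewrite big_nil mulr0.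
  by rewrite !big1 // => p _; rewrite muln0.
rewrite negb_forall => /existsP[Q]; rewrite negb_forall => /existsP[y].
rewrite negb_imply negb_exists => /andP[pQ /forallP Ay].
have {}Ay h : h \in Q -> (0 < A (y * h)%g)%N.
  by move=> Qh; have := Ay h; rewrite Qh lt0n.
(* [I] is the indicator of the coset of [Q] through [y]; the truncated subtraction is exact because
   [A] is positive on that coset. *)
pose I h : nat := (y^-1 * h \in Q)%g; pose A' h := (A h - I h)%N.
have AE h : A h = (A' h + I h)%N.
  rewrite subnK // /I; case: (boolP (_ \in Q)) => // /Ay.
  by rewrite mulKVg.
have wI : (\sum_h I h = #|Q|)%N.
  rewrite -sum1_card -(sum_lcoset Q y (fun=> 1%N)).
  by apply: eq_bigr => h _; rewrite /I; case: (_ \in Q).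
have wA : (\sum_h A h = \sum_h A' h + #|Q|)%N.
  by rewrite -wI -big_split /=; apply: eq_bigr => h _.
have sumA (V : nmodType) (F : gT -> V) :
    \sum_h F h *+ A h = \sum_h F h *+ A' h + \sum_(h in Q) F (y * h)%g.
  rewrite -sum_lcoset -big_split; apply: eq_bigr => h _.
  by rewrite {1}AE mulrnDr.
have Q1 := prime_gt1 pQ.
have [||| s [sp sE sw]] := IHn A'; [by lia | | by lia | ].
  move: A0; rewrite sumA; under [X in _ + X]eq_bigr do rewrite chiM.
  by rewrite -mulr_sumr sum_chi_eq0 // mulr0 addr0.
have Q28 : (#|Q| < 28)%N by lia.
pose p := Ordinal Q28.
exists (fun r : nat => if r == #|Q| then y :: s r else s r); split.
- move=> r; case: (r =P _) => [-> _|_]; last exact: sp.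
  by rewrite pQ -cardsT cardSg ?subsetT.
- rewrite sumA sE (bigD1 p) //= [RHS](bigD1 p) //= eqxx big_cons mulrDr.
  rewrite [LHS]addrC addrA; congr (_ + _ + _).
    rewrite /zg_D (subgroup_of_order_uniq (H := Q)) // mulr_suml.
    apply: eq_bigr => h Qh; rewrite -zg_eltM; congr (zg_elt _).
    by apply: (centsP (cyclic_abelian cycT)); rewrite in_setT.
  by apply: eq_bigr => r rp; rewrite (negPf (rp : (r : nat) != #|Q|)).
- rewrite wA sw (bigD1 p) //= [RHS](bigD1 p) //= eqxx /= mulnS.
  rewrite [LHS]addnC addnA; congr (_ + _ + _)%N.
  by apply: eq_bigr => r rp; rewrite (negPf (rp : (r : nat) != #|Q|)).
Qed.

End VanishingSums.

(** * Autocorrelation of a bent function *)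

(** The Fourier transform of the autocorrelation is the squared modulus of that of [z ^+ f], hence
    constant, so the autocorrelation is supported at 0. *)
Lemma bent_autocorrelation (G : finZmodType) (m : nat) (z : algC)
    (f : G -> 'Z_m) (x : G) :
  (1 < m)%N -> m.-primitive_root z -> generalized_bent z f -> x != 0 ->
  \sum_y z ^+ (f (x + y) - f y)%R = 0.
Proof.
move=> m1 hz hf x0.
have zm : z ^+ m = 1 by apply: prim_expr_order.
have nz : `|z| = 1.
  apply/eqP; have := pexprn_eq1 m (normr_ge0 z).
  by rewrite -normrX zm normr1 eqxx gtn_eqF ?(ltnW m1).
(* Conjugation inverts powers of [z] since [z] has modulus 1; reducing [a - b] modulo [m] is
   harmless since [z ^+ m = 1]. *)
have zB (a b : 'Z_m) : z ^+ (a - b)%R = z ^+ a * (z ^+ b)^*.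
  have zb : (z ^+ b)^* * z ^+ b = 1 by rewrite mulrC -normCK normrX nz !expr1n.
  have zb0 : z ^+ b != 0.
    by apply/eqP => e; move/eqP: zb; rewrite e mulr0 eq_sym oner_eq0.
  apply: (mulIf zb0); rewrite -mulrA zb mulr1 -exprD -(prim_expr_mod hz).
  by move: (a - b) (subrK b a) => c <- /=; rewrite [X in _ = _ ^+ (_ %% X)%N]Zp_cast.
pose e d : algC := \sum_y z ^+ (f (d + y) - f y)%R.
have cG : abelian [set: G] by apply/centsP => a _ b _; apply: FinRing.zmod_mulgC.
have lin i : 'chi[[set: G]]_i \is a linear_char by apply/char_abelianP.
have bent i : \sum_d e d * 'chi[[set: G]]_i d = #|G|%:R.
  have li := lin i; rewrite -(hf _ li) normCK rmorph_sum mulr_suml.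
  under [RHS]eq_bigr do rewrite mulr_sumr.
  under [LHS]eq_bigr do rewrite /e mulr_suml.
  rewrite exchange_big [RHS]exchange_big /=; apply: eq_bigr => y _.
  rewrite [RHS](reindex_inj (addIr y)) /=; apply: eq_bigr => d _.
  have -> : 'chi_i (d + y) = 'chi_i d * 'chi_i y.
    by apply: (lin_charM li); rewrite in_setT.
  have chiy : 'chi_i y * ('chi_i y)^* = 1.
    by rewrite -normCK normC_lin_char ?expr1n // in_setT.
  by rewrite zB rmorphM -[LHS]mulr1 -chiy; ring.
have clG a b : (a \in b ^: [set: G])%g = (a == b).
  apply/imsetP/eqP => [[c _ ->]|->]; last by exists 1%g; rewrite ?in_setT ?conjg1.
  by rewrite conjgE FinRing.zmod_mulgC mulgK.
have orth d : \sum_i 'chi[[set: G]]_i d * ('chi_i x)^* = #|G|%:R *+ (d == x).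
  rewrite (@second_orthogonality_relation _ [set: G]%G) ?in_setT // clG.
  congr (_%:R *+ _); rewrite -cardsT; apply: eq_card => c.
  rewrite [RHS]in_setT in_setI in_setT; apply/cent1P.
  exact: FinRing.zmod_mulgC.
have c0 i : 'chi[[set: G]]_i (0 : G) = 1 := lin_char1 (lin i).
have s0 : \sum_i ('chi[[set: G]]_i x)^* = 0.
  have := orth 0; rewrite eq_sym (negPf x0) mulr0n => o0.
  by apply: etrans o0; apply: eq_bigr => i _; rewrite c0 mul1r.
(* Inversion at [x]: by second orthogonality the left side is also [#|G|] times [e x]. *)
have : \sum_i (\sum_d e d * 'chi[[set: G]]_i d) * ('chi_i x)^* = 0.
  by under eq_bigr => i _ do rewrite bent; rewrite -mulr_sumr s0 mulr0.
have inner d : \sum_i e d * 'chi[[set: G]]_i d * ('chi_i x)^*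
    = e d * (#|G|%:R *+ (d == x)).
  by rewrite -orth mulr_sumr; apply: eq_bigr => i _; rewrite mulrA.
rewrite (eq_bigr _ (fun i _ => mulr_suml _ _ _ _)) exchange_big /=.
rewrite (eq_bigr _ (fun d _ => inner d)) (bigD1 x) //= big1 => [|d /negPf->].
  rewrite addr0 eqxx => /eqP; rewrite mulf_eq0 pnatr_eq0 -cardsT.
  by rewrite gtn_eqF ?cardG_gt0 // orbF => /eqP.
by rewrite mulr0.
Qed.

(** * Partitions of 27 into primes at least 5 *)

Lemma sum_primes_5_28 (V : nmodType) (F : nat -> V) :
  (forall k, ~~ (prime k && (5 <= k)%N) -> F k = 0) ->
  \sum_(k < 28) F k = F 5 + F 7 + F 11 + F 13 + F 17 + F 19 + F 23.
Proof.
move=> F0; rewrite -(big_mkord xpredT F).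
rewrite (bigID (fun k => prime k && (5 <= k)%N)) /= [X in _ + X]big1 // addr0.
rewrite -big_filter (_ : filter _ _ = [:: 5; 7; 11; 13; 17; 19; 23]%N) //.
by rewrite !big_cons big_nil addr0 !addrA.
Qed.

(** The unknowns are the multiplicities of the primes from 5 to 23. Bounding all but [a] first
    leaves finitely many linear cases. *)
Lemma partitions_27 (a b c d e i j : nat) :
  (5 * a + 7 * b + 11 * c + 13 * d + 17 * e + 19 * i + 23 * j = 27)%N ->
  [\/ (a, b, c, d, e, i, j) = (4, 1, 0, 0, 0, 0, 0),
      (a, b, c, d, e, i, j) = (1, 0, 2, 0, 0, 0, 0),
      (a, b, c, d, e, i, j) = (2, 0, 0, 0, 1, 0, 0)
    | (a, b, c, d, e, i, j) = (0, 2, 0, 1, 0, 0, 0)]%N.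
Proof.
move=> sum27.
have : (j = 0 /\ i = 0 /\ (e = 0 \/ e = 1) /\ (d = 0 \/ d = 1) /\
  (c = 0 \/ c = 1 \/ c = 2) /\ (b = 0 \/ b = 1 \/ b = 2 \/ b = 3))%N by lia.
case=> ? [? [[]? [[]? [[|[]]? [|[|[]]]?]]]]; subst; try lia.
all: have Ea : (a = 4 \/ a = 1 \/ a = 2 \/ a = 0)%N by lia.
all: by case: Ea => [|[|[]]] ?; subst; try lia;
  do [by constructor 1|by constructor 2|by constructor 3|by constructor 4].
Qed.

(** * The four forms *)

Theorem theorem3p3 (t : nat) (p alpha : 'I_t -> nat) (m : nat)
    (ht : (0 < t)%N)
    (hprime : forall j, prime (p j))
    (hp5 : forall j, (5 <= p j)%N)
    (hincr : forall i j : 'I_t, (i < j)%N -> (p i < p j)%N)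
    (halpha : forall j, (0 < alpha j)%N)
    (hm : m = (\prod_(j < t) p j ^ alpha j)%N)
    (z : algC) (hz : m.-primitive_root z)
    (gT : finGroupType) (g : gT)
    (hcard : #|gT| = m) (hg : generator [set: gT] g)
    (f : 'rV['Z_3]_3 -> 'Z_m) (hf : generalized_bent z f)
    (x : 'rV['Z_3]_3) (hx : x != 0) :
  let u := fun n : int => zg_elt (expgz g n) in
  let D := zg_D gT in
  let E := zg_E g f x in
  exists a b c d w : int,
    [\/ [/\ (5 %| m)%N, (7 %| m)%N
          & E = D 5%N * (u a + u b + u c + u d) + D 7%N * u w],
        [/\ (5 %| m)%N, (11 %| m)%N
          & E = D 5%N * u a + D 11%N * (u b + u c)],
        [/\ (5 %| m)%N, (17 %| m)%N
          & E = D 5%N * (u a + u b) + D 17%N * u c]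
      | [/\ (7 %| m)%N, (13 %| m)%N
          & E = D 7%N * (u a + u b) + D 13%N * u c]].
Proof.
move=> u D E.
have p5 q : prime q -> (q %| #|gT|)%N -> (5 <= q)%N.
  move=> pq; rewrite hcard hm Euclid_dvd_prod // big_orE => /existsP[j /=].
  rewrite Euclid_dvdX // => /andP[]; rewrite dvdn_prime2 // => /eqP -> _.
  exact: hp5.
have m1 : (1 < m)%N.
  have pm : (p (Ordinal ht) %| m)%N.
    rewrite hm (bigD1 (Ordinal ht)) //= dvdn_mulr //.
    by rewrite -{1}[p _]expn1 dvdn_exp2l.
  have m0 := prim_order_gt0 hz.
  by have := dvdn_leq m0 pm; have := hp5 (Ordinal ht); lia.
have genT : [set: gT] = <[g]>%g by apply/eqP.
have og : #[g]%g = m by rewrite orderE -genT cardsT.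
have cycT : cyclic [set: gT] by apply/cyclicP; exists g.
have gP (h : gT) : exists k, h == (g ^+ k)%g.
  have /cycleP[k ->] : h \in <[g]>%g by rewrite -genT in_setT.
  by exists k.
(* A discrete logarithm to the base [g]; through it [chi] becomes the faithful character sending [g]
   to [z]. *)
pose lg (h : gT) := xchoose (gP h); have lgK h : (g ^+ lg h)%g = h.
  exact/esym/eqP/(xchooseP (gP h)).
pose chi (h : gT) : algC := z ^+ lg h.
have chig k : chi (g ^+ k)%g = z ^+ k.
  apply/eqP; rewrite /chi (eq_prim_root_expr hz) -og -eq_expg_mod_order.
  by rewrite lgK.
have chiM : {morph chi : h k / (h * k)%g >-> h * k}.
  by move=> h k; rewrite -[h]lgK -[k]lgK -expgD !chig exprD.
have chi1 : chi 1%g = 1 by rewrite -(expg0 g) chig expr0.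
have chi_inj h : chi h = 1 -> h = 1%g.
  rewrite -(lgK h) chig => /eqP; rewrite -(prim_order_dvd hz) -og order_dvdn.
  by move/eqP.
(* [A h] is the coefficient of [h] in [E]. *)
pose A (h : gT) := #|[set y | (g ^+ (f (x + y) - f y)%R)%g == h]|.
have sumA (V : nmodType) (F : gT -> V) :
    \sum_h F h *+ A h = \sum_y F (g ^+ (f (x + y) - f y)%R)%g.
  rewrite [RHS](partition_big (fun y => g ^+ (f (x + y) - f y)%R)%g xpredT) //=.
  apply: eq_bigr => h _; rewrite /A.
  rewrite [RHS](eq_bigr (fun=> F h)) => [|y /eqP -> //].
  by rewrite sumr_const; congr (_ *+ _); apply: eq_card => y; rewrite inE.
have wA : (\sum_h A h = 27)%N.
  transitivity #|{: 'rV['Z_3]_3}|; last by rewrite card_mx card_ord.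
  rewrite -sum1_card (partition_big (fun y => g ^+ (f (x + y) - f y)%R)%g xpredT) //=.
  by apply: eq_bigr => h _; rewrite /A -sum1_card; apply: eq_bigl => y; rewrite inE.
have A0 : \sum_h chi h *+ A h = 0.
  rewrite sumA; under eq_bigr do rewrite chig.
  exact: bent_autocorrelation hf hx.
have EA : E = \sum_h zg_elt h *+ A h by rewrite sumA.
have [|s [sp sE sw]] := coset_decomposition cycT chiM chi1 chi_inj p5 A0; first by rewrite wA.
rewrite -EA in sE; rewrite wA in sw.
have s_nil k : ~~ (prime k && (5 <= k)%N) -> s k = [::].
  move=> nk; apply/eqP; apply: contraNT nk => /sp/andP[pk kT].
  by rewrite pk p5.
have sdvd k : s k != [::] -> (k %| m)%N by case/sp/andP; rewrite hcard.
have uE h : u (lg h) = zg_elt h by rewrite /u /= lgK.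
rewrite (sum_primes_5_28 (F := fun k => D k * \sum_(y <- s k) zg_elt y)) in sE; last first.
  by move=> k /s_nil ->; rewrite big_nil mulr0.
rewrite (sum_primes_5_28 (F := fun k => k * size (s k))%N) in sw; last first.
  by move=> k /s_nil ->; rewrite muln0.
move: (sdvd 5%N) (sdvd 7%N) (sdvd 11%N) (sdvd 13%N) (sdvd 17%N) sE sw.
move: (s 5%N) (s 7%N) (s 11%N) (s 13%N) (s 17%N) (s 19%N) (s 23%N).
move=> s5 s7 s11 s13 s17 s19 s23 d5 d7 d11 d13 d17 -> sw.
(* The sizes of the lists form one of the four partitions, and each list then supplies the exponents
   of one form. *)
have := partitions_27 (esym sw); move: sw => _.
case=> -[+ + + + + /size0nil-> /size0nil->].
- case: s5 d5 => [|h1 [|h2 [|h3 [|h4 [|]]]]] // d5 _.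
  case: s7 d7 => [|h5 [|]] // d7 _ /size0nil-> /size0nil-> /size0nil->.
  exists (lg h1), (lg h2), (lg h3), (lg h4), (lg h5).
  constructor 1; split; [exact: d5 | exact: d7 |].
  by rewrite !uE !big_cons !big_nil !mulr0 !addr0 !addrA.
- case: s5 d5 => [|h1 [|]] // d5 _ /size0nil->.
  case: s11 d11 => [|h2 [|h3 [|]]] // d11 _ /size0nil-> /size0nil->.
  (* This form has three exponents; the other two witnesses are set to 0. *)
  exists (lg h1), (lg h2), (lg h3), 0, 0.
  constructor 2; split; [exact: d5 | exact: d11 |].
  by rewrite !uE !big_cons !big_nil !mulr0 !addr0.
- case: s5 d5 => [|h1 [|h2 [|]]] // d5 _ /size0nil-> /size0nil-> /size0nil->.
  case: s17 d17 => [|h3 [|]] // d17 _.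
  exists (lg h1), (lg h2), (lg h3), 0, 0.
  constructor 3; split; [exact: d5 | exact: d17 |].
  by rewrite !uE !big_cons !big_nil !mulr0 !addr0.
- move=> /size0nil->; case: s7 d7 => [|h1 [|h2 [|]]] // d7 _ /size0nil->.
  case: s13 d13 => [|h3 [|]] // d13 _ /size0nil->.
  exists (lg h1), (lg h2), (lg h3), 0, 0.
  constructor 4; split; [exact: d7 | exact: d13 |].
  by rewrite !uE !big_cons !big_nil !mulr0 !addr0 add0r.
Qed.
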